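(* Let $\varepsilon\in\{-1,0\}$. Then for $\alpha,\beta>0$ with $1+\varepsilon\alpha^2>0$ and $1-\varepsilon\beta^2>0$, for $s,\tilde s\in\mathbb{R}$, and $u_0^{\ell},u_0^{m}\in\mathbb{R}$, the two families of lines $(\ell_i)_{i\in\mathbb{Z}}$ and $(m_j)_{j\in\mathbb{Z}}$ given by $$\ell_{2k}=\mathbf{v}_+(u_0^{\ell}+k(s+\tilde s)),\qquad \ell_{2k+1}=\mathbf{v}_-(u_0^{\ell}+k(s+\tilde s)+s),$$ $$m_{2l}=\mathbf{v}_-(u_0^{m}+l(s+\tilde s)),\qquad m_{2l+1}=\mathbf{v}_+(u_0^{m}+l(s+\tilde s)+s),\qquad k,l\in\mathbb{Z},$$ constitute a hyperbolic/Euclidean checkerboard incircular net (for $\varepsilon=-1$, $\varepsilon=0$, respectively) tangent to the hyperbola $$\frac{x_1^2}{\alpha^2}-\frac{x_2^2}{\beta^2}-x_3^2=0 .$$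
   Context: The Laguerre quadric is $\mathcal{B}=\{[x]\in\mathbb{R}\mathrm{P}^3: x_1^2+x_2^2+\varepsilon x_3^2-x_4^2=0\}$ ($\varepsilon=-1$ hyperbolic, $\varepsilon=0$ Euclidean). Oriented lines of the respective plane are identified with points of $\mathcal{B}$ (for $\varepsilon=0$ excluding the vertex $[0,0,1,0]$): $[x_1,x_2,x_3,x_4]$ represents the line $\{[y_1,y_2,y_3]: x_1y_1+x_2y_2+\varepsilon'x_3y_3=0\}$ in homogeneous coordinates of the plane, with $\varepsilon'=-1$ if $\varepsilon=-1$ and $\varepsilon'=1$ if $\varepsilon=0$; changing the sign of $x_4$ reverses the orientation. Four oriented lines touch a common oriented (Laguerre) circle iff the corresponding points of $\mathcal{B}$ are coplanar. A checkerboard incircular net consists of two families $(\ell_i)_{i\in\mathbb{Z}}$, $(m_j)_{j\in\mathbb{Z}}$ of oriented lines such that for all $i,j$ with $i+j$ even the four lines $\ell_i,\ell_{i+1},m_j,m_{j+1}$ touch a common oriented circle. It is tangent to a conic if all of its lines are tangent to the conic. For $u\in\mathbb{R}$, with Jacobi elliptic functions of modulus $k$ (here and in the next two formulas $k$ denotes the modulus, not the integer index in the claim), $$\mathbf{v}_\pm(u)=\left[\frac{1}{\sqrt{1+\varepsilon\alpha^2}}\operatorname{dn}(u,k),\ \frac{\alpha}{\sqrt{\alpha^2+\beta^2}}\operatorname{sn}(u,k),\ \frac{\alpha}{\sqrt{1+\varepsilon\alpha^2}}\operatorname{cn}(u,k),\ \pm1\right],$$ $$k^2=\frac{\alpha^2(1-\varepsilon\beta^2)}{\alpha^2+\beta^2}.$$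 *)

(* Defs.v *)
(* Stdlib real numbers with Coquelicot. *)
From Stdlib Require Import Reals ZArith.
From Coquelicot Require Import Coquelicot.
Open Scope R_scope.

(* Points of RP^2 and RP^3 are given by homogeneous coordinate vectors; every
   predicate below is invariant under nonzero rescaling of these vectors. *)
Definition vec3 : Type := (R * R * R)%type.
Definition vec4 : Type := (R * R * R * R)%type.

Definition scale4 (c : R) (x : vec4) : vec4 :=
  let '(x1, x2, x3, x4) := x in (c * x1, c * x2, c * x3, c * x4).

(* Equality of the points of RP^3 with homogeneous coordinates x and y. *)
Definition proj_eq (x y : vec4) : Prop :=
  exists c : R, c <> 0 /\ x = scale4 c y.

Inductive plane_geometry : Set := Hyperbolic | Euclidean.

Definition eps (g : plane_geometry) : R :=
  match g with Hyperbolic => -1 | Euclidean => 0 end.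

Definition eps' (g : plane_geometry) : R :=
  match g with Hyperbolic => -1 | Euclidean => 1 end.

Definition on_Laguerre_quadric (g : plane_geometry) (x : vec4) : Prop :=
  let '(x1, x2, x3, x4) := x in
  x1 ^ 2 + x2 ^ 2 + eps g * x3 ^ 2 - x4 ^ 2 = 0.

Definition oriented_line (g : plane_geometry) (x : vec4) : Prop :=
  x <> (0, 0, 0, 0) /\ on_Laguerre_quadric g x /\
  (g = Euclidean -> ~ proj_eq x (0, 0, 1, 0)).

(* The point y of RP^2 lies on the (unoriented) line represented by x. *)
Definition on_line (g : plane_geometry) (x : vec4) (y : vec3) : Prop :=
  let '(x1, x2, x3, _) := x in
  let '(y1, y2, y3) := y in
  x1 * y1 + x2 * y2 + eps' g * x3 * y3 = 0.

(* Oriented Laguerre circles are the plane sections of the Laguerre quadric: a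
   circle is given by the coefficient vector of a plane of RP^3, and it touches
   the oriented lines whose points lie in that plane. *)
Definition Laguerre_circle (a : vec4) : Prop := a <> (0, 0, 0, 0).

Definition touches (x a : vec4) : Prop :=
  let '(x1, x2, x3, x4) := x in
  let '(a1, a2, a3, a4) := a in
  a1 * x1 + a2 * x2 + a3 * x3 + a4 * x4 = 0.

Definition touch_common_circle (x y z w : vec4) : Prop :=
  exists a : vec4, Laguerre_circle a /\
    touches x a /\ touches y a /\ touches z a /\ touches w a.

Definition checkerboard_incircular_net (g : plane_geometry)
    (l m : Z -> vec4) : Prop :=
  (forall i : Z, oriented_line g (l i)) /\
  (forall j : Z, oriented_line g (m j)) /\
  (forall i j : Z, Z.Even (i + j) ->
     touch_common_circle (l i) (l (i + 1)%Z) (m j) (m (j + 1)%Z)).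

(* A conic is given by a symmetric bilinear form b, as {[y] : b y y = 0}; its
   tangent line at one of its points p is the polar line {[y] : b p y = 0}. *)
Definition tangent_to (g : plane_geometry) (b : vec3 -> vec3 -> R)
    (x : vec4) : Prop :=
  exists p : vec3, p <> (0, 0, 0) /\ b p p = 0 /\
    forall y : vec3, on_line g x y <-> b p y = 0.

Definition net_tangent_to (g : plane_geometry) (b : vec3 -> vec3 -> R)
    (l m : Z -> vec4) : Prop :=
  (forall i : Z, tangent_to g b (l i)) /\ (forall j : Z, tangent_to g b (m j)).

(* The hyperbola x1^2 / alpha^2 - x2^2 / beta^2 - x3^2 = 0. *)
Definition hyperbola (alpha beta : R) (x y : vec3) : R :=
  let '(x1, x2, x3) := x in
  let '(y1, y2, y3) := y in
  x1 * y1 / alpha ^ 2 - x2 * y2 / beta ^ 2 - x3 * y3.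

(* Jacobi elliptic functions of modulus k (not parameter k^2), for 0 <= k < 1:
   the amplitude is the inverse of the incomplete elliptic integral of the
   first kind. *)
Definition ellipticF (k phi : R) : R :=
  RInt (fun t => / sqrt (1 - k ^ 2 * sin t ^ 2)) 0 phi.

Definition am (u k : R) : R := iota (fun phi : R => ellipticF k phi = u).

Definition sn (u k : R) : R := sin (am u k).
Definition cn (u k : R) : R := cos (am u k).
Definition dn (u k : R) : R := sqrt (1 - k ^ 2 * sn u k ^ 2).

Definition modulus (g : plane_geometry) (alpha beta : R) : R :=
  sqrt (alpha ^ 2 * (1 - eps g * beta ^ 2) / (alpha ^ 2 + beta ^ 2)).

(* The points v_+(u) and v_-(u), with last coordinate sgn = 1 and sgn = -1. *)
Definition v_sgn (sgn : R) (g : plane_geometry) (alpha beta u : R) : vec4 :=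
  let k := modulus g alpha beta in
  (/ sqrt (1 + eps g * alpha ^ 2) * dn u k,
   alpha / sqrt (alpha ^ 2 + beta ^ 2) * sn u k,
   alpha / sqrt (1 + eps g * alpha ^ 2) * cn u k,
   sgn).

Definition v_plus := v_sgn 1.
Definition v_minus := v_sgn (-1).

(* Main.v *)
(* Up to scale, v_-(u) is v_+(2iK' - u), so four points v_+(a), v_-(b), v_-(c),
   v_+(d) with a + d = b + c correspond to arguments summing to a period and are
   coplanar. Staying over the reals, this is an explicit plane obtained from the
   addition formulas of sn, cn, dn, which hold because their right-hand sides
   have zero derivative along u + v = const. That the lines lie on the quadric
   and are tangent to the hyperbola reduces to cn^2 = 1 - sn^2 and
   dn^2 = 1 - k^2 sn^2 with the given modulus. *)
Require Import Defs.
From Stdlib Require Import Reals ZArith Lra Lia Classical.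
From Coquelicot Require Import Coquelicot.
Open Scope R_scope.

(** * The elliptic integral of the first kind and its inverse, the amplitude *)

Lemma is_derive_zero_const (f : R -> R) (a b : R) :
  (forall t, is_derive f t 0) -> f a = f b.
Proof.
  intros Hf.
  destruct (Rtotal_order a b) as [Hab | [-> | Hab]].
  - apply (eq_is_derive f a b); auto.
  - reflexivity.
  - symmetry; apply (eq_is_derive f b a); auto.
Qed.

Lemma elliptic_radicand_pos (k phi : R) :
  k ^ 2 < 1 -> 0 < 1 - k ^ 2 * sin phi ^ 2.
Proof.
  intros Hk.
  pose proof (SIN_bound phi).
  assert (sin phi ^ 2 <= 1) by nra.
  pose proof (pow2_ge_0 k); pose proof (pow2_ge_0 (sin phi)); nra.
Qed.

Lemma sqrt_elliptic_radicand_le_1 (k phi : R) :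
  sqrt (1 - k ^ 2 * sin phi ^ 2) <= 1.
Proof.
  rewrite <- sqrt_1 at 2. apply sqrt_le_1_alt.
  pose proof (Rmult_le_pos _ _ (pow2_ge_0 k) (pow2_ge_0 (sin phi))); lra.
Qed.

Lemma is_derive_ellipticF (k phi : R) :
  k ^ 2 < 1 ->
  is_derive (ellipticF k) phi (/ sqrt (1 - k ^ 2 * sin phi ^ 2)).
Proof.
  intros Hk.
  assert (Hcont : forall t, continuous (fun t => / sqrt (1 - k ^ 2 * sin t ^ 2)) t).
  { intros t. apply (ex_derive_continuous (V := R_NormedModule)).
    pose proof (elliptic_radicand_pos k t Hk).
    auto_derive; repeat split.
    - simpl in *; lra.
    - apply Rgt_not_eq, sqrt_lt_R0; simpl in *; lra. }
  unfold ellipticF.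
  apply (is_derive_RInt (V := R_NormedModule)
    (fun t => / sqrt (1 - k ^ 2 * sin t ^ 2)) _ 0); [| apply Hcont].
  apply filter_forall; intros x.
  apply (RInt_correct (V := R_CompleteNormedModule)).
  apply (ex_RInt_continuous (V := R_CompleteNormedModule)); intros; apply Hcont.
Qed.

Lemma ellipticF_0 (k : R) : ellipticF k 0 = 0.
Proof. apply (RInt_point (V := R_CompleteNormedModule)). Qed.

(** The integrand is even, so [ellipticF k t + ellipticF k (- t)] has zero derivative and keeps its
    value at [t = 0]. *)
Lemma ellipticF_opp (k phi : R) :
  k ^ 2 < 1 -> ellipticF k (- phi) = - ellipticF k phi.
Proof.
  intros Hk.
  assert (H : ellipticF k phi + ellipticF k (- phi)
              = ellipticF k 0 + ellipticF k (- 0)).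
  { apply (is_derive_zero_const (fun t => ellipticF k t + ellipticF k (- t))).
    intros t.
    pose proof (is_derive_ellipticF k t Hk) as H1.
    pose proof (is_derive_ellipticF k (- t) Hk) as H2.
    rewrite sin_neg in H2.
    replace ((- sin t) ^ 2) with (sin t ^ 2) in H2 by ring.
    auto_derive.
    - repeat split; eexists; eassumption.
    - rewrite (is_derive_unique (fun x : R => ellipticF k x) _ _ H1).
      rewrite (is_derive_unique (fun x : R => ellipticF k x) _ _ H2). ring. }
  rewrite Ropp_0, ellipticF_0 in H; lra.
Qed.

(** Mean value theorem with an integrand that is at least 1. This single bound yields injectivity
    and unboundedness of [ellipticF k], and later controls the difference quotients of its
    inverse. *)
Lemma ellipticF_slope_ge_1 (k a b : R) :
  k ^ 2 < 1 ->
  exists q, 1 <= q /\ ellipticF k b - ellipticF k a = q * (b - a).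
Proof.
  intros Hk.
  destruct (MVT_gen (ellipticF k) a b
    (fun t => / sqrt (1 - k ^ 2 * sin t ^ 2))) as [c [_ Hc]].
  - intros; now apply is_derive_ellipticF.
  - intros x _. apply continuity_pt_filterlim.
    apply (ex_derive_continuous (V := R_NormedModule)).
    eexists; now apply is_derive_ellipticF.
  - eexists; split; [| exact Hc].
    pose proof (elliptic_radicand_pos k c Hk) as Hpos.
    rewrite <- Rinv_1 at 1. apply Rinv_le_contravar; [now apply sqrt_lt_R0 |].
    apply sqrt_elliptic_radicand_le_1.
Qed.

(** Since [am] is a definite description, it has this property once a preimage of [u] exists and is
    unique; the slope bound gives both. *)
Lemma ellipticF_am (k u : R) : k ^ 2 < 1 -> ellipticF k (am u k) = u.
Proof.
  intros Hk. unfold am.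
  apply (iota_correct (V := R_CompleteNormedModule) (fun phi : R => ellipticF k phi = u)).
  (* These endpoints bracket [u]: slope at least 1 gives [Rabs u <= ellipticF k (Rabs u)], and
     oddness gives the lower end. *)
  destruct (IVT_gen (ellipticF k) (- Rabs u) (Rabs u) u) as [x [_ Hx]].
  - intros x. apply continuity_pt_filterlim.
    apply (ex_derive_continuous (V := R_NormedModule)).
    eexists; now apply is_derive_ellipticF.
  - destruct (ellipticF_slope_ge_1 k 0 (Rabs u) Hk) as [q [Hq H]].
    rewrite ellipticF_0 in H.
    rewrite ellipticF_opp by assumption.
    assert (Rabs u <= ellipticF k (Rabs u)) by (pose proof (Rabs_pos u); nra).
    pose proof (Rle_abs u); pose proof (Rle_abs (- u)); rewrite Rabs_Ropp in *.
    pose proof (Rmin_l (- ellipticF k (Rabs u)) (ellipticF k (Rabs u))).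
    pose proof (Rmax_r (- ellipticF k (Rabs u)) (ellipticF k (Rabs u))).
    lra.
  - exists x; split; [exact Hx |].
    intros y Hy.
    destruct (ellipticF_slope_ge_1 k x y Hk) as [q [Hq H]].
    rewrite Hx, Hy in H. nra.
Qed.

Lemma am_ellipticF (k phi : R) : k ^ 2 < 1 -> am (ellipticF k phi) k = phi.
Proof.
  intros Hk.
  destruct (ellipticF_slope_ge_1 k phi (am (ellipticF k phi) k) Hk) as [q [Hq H]].
  rewrite ellipticF_am in H by assumption. nra.
Qed.

Lemma am_0 (k : R) : k ^ 2 < 1 -> am 0 k = 0.
Proof. intros Hk. rewrite <- (ellipticF_0 k) at 1. now apply am_ellipticF. Qed.

Lemma am_opp (k u : R) : k ^ 2 < 1 -> am (- u) k = - am u k.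
Proof.
  intros Hk.
  rewrite <- (ellipticF_am k u Hk) at 1.
  rewrite <- ellipticF_opp by assumption. now apply am_ellipticF.
Qed.

Lemma dn_pos (k u : R) : k ^ 2 < 1 -> 0 < dn u k.
Proof. intros Hk. apply sqrt_lt_R0. now apply elliptic_radicand_pos. Qed.

(* Since [F' >= 1], difference quotients of [am] are the inverses [1 / q] of
   difference quotients of [F] with [q >= 1], and
   [|1 / q - 1 / F'| <= |q - F'|]. *)
Lemma is_derive_am (k u : R) :
  k ^ 2 < 1 -> is_derive (fun t => am t k) u (dn u k).
Proof.
  intros Hk.
  pose proof (is_derive_ellipticF k (am u k) Hk) as HF.
  fold (sn u k) in HF; fold (dn u k) in HF.
  pose proof (dn_pos k u Hk) as Hd.
  assert (Hd1 : dn u k <= 1).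
  { apply sqrt_elliptic_radicand_le_1. }
  apply is_derive_Reals in HF. apply is_derive_Reals.
  intros eps Heps.
  destruct (HF eps Heps) as [delta Hdelta].
  exists delta. intros h Hh Hhd.
  set (e := am (u + h) k - am u k).
  destruct (ellipticF_slope_ge_1 k (am u k) (am (u + h) k) Hk) as [q [Hq H]].
  rewrite !ellipticF_am in H by assumption. fold e in H.
  assert (He : h = q * e) by lra.
  assert (He0 : e <> 0) by (intros E; apply Hh; rewrite He, E; ring).
  assert (Hed : Rabs e < delta).
  { apply Rle_lt_trans with (2 := Hhd). rewrite He, Rabs_mult.
    rewrite (Rabs_pos_eq q) by lra. pose proof (Rabs_pos e); nra. }
  specialize (Hdelta e He0 Hed).
  replace (am u k + e) with (am (u + h) k) in Hdelta by (unfold e; ring).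
  rewrite !ellipticF_am in Hdelta by assumption.
  replace ((u + h - u) / e) with q in Hdelta
    by (replace (u + h - u) with (q * e) by lra; field; exact He0).
  replace (e / h - dn u k) with (- (q - / dn u k) * (dn u k / q))
    by (rewrite He; field; repeat split; lra).
  rewrite Rabs_mult, Rabs_Ropp.
  assert (0 <= dn u k / q <= 1).
  { split; [apply Rlt_le, Rdiv_lt_0_compat; lra |].
    apply Rmult_le_reg_r with q; [lra |]. unfold Rdiv.
    rewrite Rmult_assoc, Rinv_l by lra. lra. }
  rewrite (Rabs_pos_eq (dn u k / q)) by lra.
  pose proof (Rabs_pos (q - / dn u k)). nra.
Qed.

(** * Algebraic relations, parity, values at 0 and derivatives of sn, cn, dn *)

Lemma cn_sqr (k u : R) : cn u k ^ 2 = 1 - sn u k ^ 2.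
Proof. unfold sn, cn. pose proof (sin2_cos2 (am u k)). unfold Rsqr in *. lra. Qed.

Lemma dn_sqr (k u : R) : k ^ 2 < 1 -> dn u k ^ 2 = 1 - k ^ 2 * sn u k ^ 2.
Proof. intros Hk. apply pow2_sqrt, Rlt_le. now apply elliptic_radicand_pos. Qed.

Lemma sn_opp (k u : R) : k ^ 2 < 1 -> sn (- u) k = - sn u k.
Proof. intros Hk. unfold sn. rewrite am_opp by assumption. apply sin_neg. Qed.

Lemma cn_opp (k u : R) : k ^ 2 < 1 -> cn (- u) k = cn u k.
Proof. intros Hk. unfold cn. rewrite am_opp by assumption. apply cos_neg. Qed.

Lemma dn_opp (k u : R) : k ^ 2 < 1 -> dn (- u) k = dn u k.
Proof.
  intros Hk. unfold dn. rewrite sn_opp by assumption.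
  now replace ((- sn u k) ^ 2) with (sn u k ^ 2) by ring.
Qed.

Lemma sn_0 (k : R) : k ^ 2 < 1 -> sn 0 k = 0.
Proof. intros Hk. unfold sn. rewrite am_0 by assumption. apply sin_0. Qed.

Lemma cn_0 (k : R) : k ^ 2 < 1 -> cn 0 k = 1.
Proof. intros Hk. unfold cn. rewrite am_0 by assumption. apply cos_0. Qed.

Lemma dn_0 (k : R) : k ^ 2 < 1 -> dn 0 k = 1.
Proof.
  intros Hk. unfold dn. rewrite sn_0 by assumption.
  rewrite <- sqrt_1 at 2. f_equal. ring.
Qed.

Lemma is_derive_sn (k u : R) :
  k ^ 2 < 1 -> is_derive (fun t => sn t k) u (cn u k * dn u k).
Proof.
  intros Hk. pose proof (is_derive_am k u Hk) as H. unfold sn.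
  auto_derive.
  - eexists; exact H.
  - rewrite (is_derive_unique (fun t : R => am t k) _ _ H). unfold cn. ring.
Qed.

Lemma is_derive_cn (k u : R) :
  k ^ 2 < 1 -> is_derive (fun t => cn t k) u (- sn u k * dn u k).
Proof.
  intros Hk. pose proof (is_derive_am k u Hk) as H. unfold cn.
  auto_derive.
  - eexists; exact H.
  - rewrite (is_derive_unique (fun t : R => am t k) _ _ H). unfold sn. ring.
Qed.

Lemma is_derive_dn (k u : R) :
  k ^ 2 < 1 -> is_derive (fun t => dn t k) u (- k ^ 2 * sn u k * cn u k).
Proof.
  intros Hk. pose proof (is_derive_sn k u Hk) as H.
  pose proof (dn_pos k u Hk) as Hd. pose proof (dn_sqr k u Hk) as Hd2.
  unfold dn.
  auto_derive.
  - repeat split; [eexists; exact H |].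
    pose proof (pow_lt (dn u k) 2 Hd); simpl in *; lra.
  - rewrite (is_derive_unique (fun t : R => sn t k) _ _ H).
    replace (sqrt _) with (dn u k) by (unfold dn; f_equal; ring).
    field. lra.
Qed.

(** * Addition formulas *)

Lemma jacobi_denominator_pos (k u v : R) :
  k ^ 2 < 1 -> 0 < 1 - k ^ 2 * sn u k ^ 2 * sn v k ^ 2.
Proof.
  intros Hk.
  pose proof (cn_sqr k u); pose proof (pow2_ge_0 (cn u k)).
  pose proof (cn_sqr k v); pose proof (pow2_ge_0 (cn v k)).
  pose proof (pow2_ge_0 k); pose proof (pow2_ge_0 (sn u k));
    pose proof (pow2_ge_0 (sn v k)).
  assert (0 <= sn u k ^ 2 * sn v k ^ 2 <= 1) by nra.
  rewrite Rmult_assoc. nra.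
Qed.

(* Reduces [is_derive f t 0], for [f] an expression in the Jacobi functions of
   [t] and [w - t], to an algebraic identity in their six values. *)
Ltac derive_jacobi k w t Hk :=
  pose proof (is_derive_sn k t Hk) as Hs1;
  pose proof (is_derive_sn k (w - t) Hk) as Hs2;
  pose proof (is_derive_cn k t Hk) as Hc1;
  pose proof (is_derive_cn k (w - t) Hk) as Hc2;
  pose proof (is_derive_dn k t Hk) as Hd1;
  pose proof (is_derive_dn k (w - t) Hk) as Hd2;
  pose proof (jacobi_denominator_pos k t (w - t) Hk) as HD;
  pose proof (cn_sqr k t) as C1; pose proof (cn_sqr k (w - t)) as C2;
  pose proof (dn_sqr k t Hk) as D1; pose proof (dn_sqr k (w - t) Hk) as D2;
  auto_derive;
  [ repeat split; try (eexists; eassumption);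
    apply Rgt_not_eq; unfold Rminus in HD; simpl in *; lra
  | rewrite ?(is_derive_unique (fun t : R => sn t k) _ _ Hs1),
      ?(is_derive_unique (fun t : R => cn t k) _ _ Hc1),
      ?(is_derive_unique (fun t : R => dn t k) _ _ Hd1);
    change (w + - t) with (w - t);
    rewrite ?(is_derive_unique (fun t : R => sn t k) _ _ Hs2),
      ?(is_derive_unique (fun t : R => cn t k) _ _ Hc2),
      ?(is_derive_unique (fun t : R => dn t k) _ _ Hd2);
    clear Hs1 Hs2 Hc1 Hc2 Hd1 Hd2;
    revert HD C1 C2 D1 D2;
    generalize (sn t k), (cn t k), (dn t k),
      (sn (w - t) k), (cn (w - t) k), (dn (w - t) k);
    intros s1 c1 d1 s2 c2 d2 HD C1 C2 D1 D2 ].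

(** Evaluated at [t] and [u + v - t], the right-hand side is constant in [t]; comparing [t = u] with
    [t = 0], where it collapses to [sn (u + v) k], gives the formula. [cn_add] and [dn_add] follow
    the same pattern. *)
Lemma sn_add (k u v : R) :
  k ^ 2 < 1 ->
  sn (u + v) k = (sn u k * (cn v k * dn v k) + sn v k * (cn u k * dn u k))
                 / (1 - k ^ 2 * sn u k ^ 2 * sn v k ^ 2).
Proof.
  intros Hk.
  assert (H := is_derive_zero_const
    (fun t => (sn t k * (cn (u + v - t) k * dn (u + v - t) k)
               + sn (u + v - t) k * (cn t k * dn t k))
              / (1 - k ^ 2 * sn t k ^ 2 * sn (u + v - t) k ^ 2)) u 0).
  cbv beta in H.
  rewrite sn_0, cn_0, dn_0, Rminus_0_r in H by assumption.
  replace (u + v - u) with v in H by ring.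
  rewrite H; [field |].
  intros t.
  derive_jacobi k (u + v) t Hk.
  (* The numerator of the derivative vanishes modulo the quadratic relations that express cn^2 and
     dn^2 through sn^2. *)
  field_simplify_eq; [ring [C1 C2 D1 D2] | simpl in *; lra].
Qed.

Lemma cn_add (k u v : R) :
  k ^ 2 < 1 ->
  cn (u + v) k = (cn u k * cn v k - sn u k * sn v k * (dn u k * dn v k))
                 / (1 - k ^ 2 * sn u k ^ 2 * sn v k ^ 2).
Proof.
  intros Hk.
  assert (H := is_derive_zero_const
    (fun t => (cn t k * cn (u + v - t) k
               - sn t k * sn (u + v - t) k * (dn t k * dn (u + v - t) k))
              / (1 - k ^ 2 * sn t k ^ 2 * sn (u + v - t) k ^ 2)) u 0).
  cbv beta in H.
  rewrite sn_0, cn_0, dn_0, Rminus_0_r in H by assumption.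
  replace (u + v - u) with v in H by ring.
  rewrite H; [field |].
  intros t.
  derive_jacobi k (u + v) t Hk.
  field_simplify_eq; [ring [C1 C2 D1 D2] | simpl in *; lra].
Qed.

Lemma dn_add (k u v : R) :
  k ^ 2 < 1 ->
  dn (u + v) k = (dn u k * dn v k - k ^ 2 * (sn u k * sn v k) * (cn u k * cn v k))
                 / (1 - k ^ 2 * sn u k ^ 2 * sn v k ^ 2).
Proof.
  intros Hk.
  assert (H := is_derive_zero_const
    (fun t => (dn t k * dn (u + v - t) k
               - k ^ 2 * (sn t k * sn (u + v - t) k) * (cn t k * cn (u + v - t) k))
              / (1 - k ^ 2 * sn t k ^ 2 * sn (u + v - t) k ^ 2)) u 0).
  cbv beta in H.
  rewrite sn_0, cn_0, dn_0, Rminus_0_r in H by assumption.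
  replace (u + v - u) with v in H by ring.
  rewrite H; [field |].
  intros t.
  derive_jacobi k (u + v) t Hk.
  field_simplify_eq; [ring [C1 C2 D1 D2] | simpl in *; lra].
Qed.

(** * Coplanarity of four points on the curve *)

(** The cross product serves unless it vanishes; then the two vectors are parallel, and any nonzero
    vector orthogonal to a nonzero one of them works. *)
Lemma common_orthogonal_exists (u1 u2 u3 v1 v2 v3 : R) :
  exists n1 n2 n3 : R, ~ (n1 = 0 /\ n2 = 0 /\ n3 = 0) /\
    n1 * u1 + n2 * u2 + n3 * u3 = 0 /\ n1 * v1 + n2 * v2 + n3 * v3 = 0.
Proof.
  assert (orth : forall a b c, exists n1 n2 n3 : R,
    ~ (n1 = 0 /\ n2 = 0 /\ n3 = 0) /\ n1 * a + n2 * b + n3 * c = 0).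
  { intros a b c. destruct (Req_dec a 0) as [-> |].
    - exists 1, 0, 0. split; [lra | ring].
    - exists b, (- a), 0. split; [lra | ring]. }
  destruct (Req_dec (u2 * v3 - u3 * v2) 0) as [E1 |];
    [destruct (Req_dec (u3 * v1 - u1 * v3) 0) as [E2 |];
     [destruct (Req_dec (u1 * v2 - u2 * v1) 0) as [E3 |] |] |];
    [| exists (u2 * v3 - u3 * v2), (u3 * v1 - u1 * v3), (u1 * v2 - u2 * v1);
       split; [tauto | split; ring] ..].
  destruct (Req_dec u1 0) as [-> |].
  - destruct (Req_dec u2 0) as [-> |].
    + destruct (Req_dec u3 0) as [-> |].
      * destruct (orth v1 v2 v3) as (n1 & n2 & n3 & Hn & H).
        exists n1, n2, n3. repeat split; [exact Hn | ring | exact H].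
      * exists 1, 0, 0. repeat split; [lra | ring |].
        apply Rmult_eq_reg_l with u3; [lra | assumption].
    + exists u2, 0, 0. repeat split; [lra | ring |].
      lra.
  - exists u2, (- u1), 0. repeat split; [lra | ring | lra].
Qed.

(* With [a = p + x], [d = p - x], [b = p + y], [c = p - y], the plane comes from
   solving the four equations after adding and subtracting them in pairs. It
   degenerates only if [y] is congruent to [x] or [- x], when the four points
   span just two lines through [(0, 0, 0, 1)]. *)
Lemma jacobi_coplanar (k a b c d : R) :
  0 < k ^ 2 < 1 -> a + d = b + c ->
  exists n1 n2 n3 n4 : R, ~ (n1 = 0 /\ n2 = 0 /\ n3 = 0 /\ n4 = 0) /\
    n1 * sn a k + n2 * cn a k + n3 * dn a k + n4 = 0 /\
    n1 * sn b k + n2 * cn b k + n3 * dn b k - n4 = 0 /\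
    n1 * sn c k + n2 * cn c k + n3 * dn c k - n4 = 0 /\
    n1 * sn d k + n2 * cn d k + n3 * dn d k + n4 = 0.
Proof.
  intros [Hk0 Hk] Hsum.
  set (p := (a + d) / 2). set (x := (a - d) / 2). set (y := (b - c) / 2).
  replace a with (p + x) by (unfold p, x; field).
  replace d with (p + - x) by (unfold p, x; field).
  replace b with (p + y) by (unfold p, y; lra).
  replace c with (p + - y) by (unfold p, y; lra).
  clearbody p x y. clear a b c d Hsum.
  pose proof (dn_pos k p Hk) as Pp. pose proof (dn_pos k x Hk) as Px.
  pose proof (jacobi_denominator_pos k p x Hk) as Dx.
  pose proof (jacobi_denominator_pos k p y Hk) as Dy.
  pose proof (cn_sqr k p) as Cp. pose proof (dn_sqr k p Hk) as Ep.
  pose proof (cn_sqr k x) as Cx. pose proof (dn_sqr k x Hk) as Ex.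
  pose proof (cn_sqr k y) as Cy. pose proof (dn_sqr k y Hk) as Ey.
  rewrite !sn_add, !cn_add, !dn_add, !sn_opp, !cn_opp, !dn_opp by assumption.
  revert Pp Px Dx Dy Cp Ep Cx Ex Cy Ey.
  generalize (sn p k), (cn p k), (dn p k), (sn x k), (cn x k), (dn x k),
    (sn y k), (cn y k), (dn y k).
  intros sp cp dp sx cx dx sy cy dy Pp Px Dx Dy Cp Ep Cx Ex Cy Ey.
  replace ((- sx) ^ 2) with (sx ^ 2) by ring.
  replace ((- sy) ^ 2) with (sy ^ 2) by ring.
  destruct (classic (cx = cy /\ dx = dy)) as [[<- <-] | Hne].
  (* Here [sy = sx] or [sy = - sx], so only two triples (sn, cn, dn) occur; a normal orthogonal to
     both, with last coefficient 0, ignores the signs of the last coordinates. *)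
  - set (Nx := 1 - k ^ 2 * sp ^ 2 * sx ^ 2) in *.
    destruct (common_orthogonal_exists
      ((sp * (cx * dx) + sx * (cp * dp)) / Nx)
      ((cp * cx - sp * sx * (dp * dx)) / Nx)
      ((dp * dx - k ^ 2 * (sp * sx) * (cp * cx)) / Nx)
      ((sp * (cx * dx) + - sx * (cp * dp)) / Nx)
      ((cp * cx - sp * - sx * (dp * dx)) / Nx)
      ((dp * dx - k ^ 2 * (sp * - sx) * (cp * cx)) / Nx))
      as (n1 & n2 & n3 & Hn & H1 & H2).
    exists n1, n2, n3, 0. split; [tauto |].
    assert (Hs : (sy - sx) * (sy + sx) = 0) by nra.
    replace (sy ^ 2) with (sx ^ 2) by lra. fold Nx.
    apply Rmult_integral in Hs.
    destruct Hs as [Hs | Hs];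
      [replace sy with sx by lra
      |replace sy with (- sx) by lra; rewrite !Ropp_involutive];
      repeat split; lra.
  (* Cancelling [sx] and [sy] from the two difference equations and subtracting fixes the ratio of
     the cn and dn coefficients; either difference then gives the sn coefficient, and a sum equation
     the last one. *)
  - exists (k ^ 2 * sp * (cx * dy - cy * dx)), (k ^ 2 * cp * (cx - cy)),
      (- dp * (dx - dy)), (k ^ 2 * cx * cy + (1 - k ^ 2) - dx * dy).
    split.
    (* As [dp > 0], the third coefficient forces [dx = dy]; the first two then kill [cx - cy], since
       [sp ^ 2 + cp ^ 2 = 1]. *)
    + intros (H1 & H2 & H3 & _). apply Hne.
      assert (Hd : dx = dy).
      { apply Rmult_integral in H3. destruct H3; lra. }
      split; [| exact Hd]. subst dy.
      assert (H1' : sp * (cx - cy) = 0).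
      { apply Rmult_eq_reg_l with (k ^ 2 * dx); [lra |].
        apply Rgt_not_eq, Rmult_lt_0_compat; assumption. }
      assert (H2' : cp * (cx - cy) = 0).
      { apply Rmult_eq_reg_l with (k ^ 2); lra. }
      assert (H : (sp ^ 2 + cp ^ 2) * (cx - cy) = 0).
      { transitivity (sp * (sp * (cx - cy)) + cp * (cp * (cx - cy))); [ring |].
        rewrite H1', H2'. ring. }
      rewrite Cp in H. lra.
    + repeat split; (field_simplify_eq; [ring [Cp Ep Cx Ex Cy Ey] | lra]).
Qed.

(** * The modulus, the Laguerre quadric and tangency to the hyperbola *)

Lemma modulus_sqr (g : plane_geometry) (alpha beta : R) :
  0 < alpha -> 0 < beta -> 0 < 1 - eps g * beta ^ 2 ->
  modulus g alpha beta ^ 2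
  = alpha ^ 2 * (1 - eps g * beta ^ 2) / (alpha ^ 2 + beta ^ 2).
Proof.
  intros Ha Hb Heb. unfold modulus. apply pow2_sqrt.
  apply Rlt_le, Rdiv_lt_0_compat; [apply Rmult_lt_0_compat |]; nra.
Qed.

(** For the upper bound, 1 - k^2 = beta^2 (1 + eps alpha^2) / (alpha^2 + beta^2). *)
Lemma modulus_bounds (g : plane_geometry) (alpha beta : R) :
  0 < alpha -> 0 < beta -> 0 < 1 + eps g * alpha ^ 2 ->
  0 < 1 - eps g * beta ^ 2 -> 0 < modulus g alpha beta ^ 2 < 1.
Proof.
  intros Ha Hb Hea Heb.
  pose proof (pow_lt alpha 2 Ha). pose proof (pow_lt beta 2 Hb).
  rewrite modulus_sqr by assumption. split.
  - apply Rdiv_lt_0_compat; [now apply Rmult_lt_0_compat | lra].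
  - apply Rmult_lt_reg_r with (alpha ^ 2 + beta ^ 2); [lra |].
    unfold Rdiv. rewrite Rmult_assoc, Rinv_l by lra. nra.
Qed.

(** On the quadric the sn^2 terms cancel because k^2 + eps alpha^2 = alpha^2 (1 + eps alpha^2) /
    (alpha^2 + beta^2). The nonzero last coordinate rules out both the zero vector and the
    vertex. *)
Lemma v_sgn_oriented_line (g : plane_geometry) (alpha beta sgn u : R) (x : vec4) :
  0 < alpha -> 0 < beta -> 0 < 1 + eps g * alpha ^ 2 ->
  0 < 1 - eps g * beta ^ 2 -> sgn ^ 2 = 1 ->
  proj_eq x (v_sgn sgn g alpha beta u) -> oriented_line g x.
Proof.
  intros Ha Hb Hea Heb Hsgn (r & Hr & ->).
  pose proof (modulus_sqr g alpha beta Ha Hb Heb) as Hk.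
  destruct (modulus_bounds g alpha beta Ha Hb Hea Heb) as [_ Hk1].
  pose proof (pow_lt alpha 2 Ha). pose proof (pow_lt beta 2 Hb).
  assert (Hs0 : r * sgn <> 0).
  { apply Rmult_integral_contrapositive_currified; [exact Hr |].
    intros ->. lra. }
  unfold v_sgn. repeat split.
  - intros E. injection E as _ _ _ E. contradiction.
  - unfold scale4, on_Laguerre_quadric.
    set (k := modulus g alpha beta) in *.
    pose proof (cn_sqr k u) as Hc. pose proof (dn_sqr k u Hk1) as Hd.
    pose proof (pow2_sqrt _ (Rlt_le _ _ Hea)) as H1.
    assert (H2 : sqrt (alpha ^ 2 + beta ^ 2) ^ 2 = alpha ^ 2 + beta ^ 2)
      by (apply pow2_sqrt; lra).
    assert (H1' := sqrt_lt_R0 _ Hea).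
    assert (H2' : 0 < sqrt (alpha ^ 2 + beta ^ 2)) by (apply sqrt_lt_R0; lra).
    rewrite Hk in Hd.
    transitivity (r ^ 2 * (dn u k ^ 2 / sqrt (1 + eps g * alpha ^ 2) ^ 2
      + alpha ^ 2 * sn u k ^ 2 / sqrt (alpha ^ 2 + beta ^ 2) ^ 2
      + eps g * alpha ^ 2 * cn u k ^ 2 / sqrt (1 + eps g * alpha ^ 2) ^ 2
      - sgn ^ 2)).
    { field. lra. }
    rewrite H1, H2, Hc, Hd, Hsgn. field. lra.
  - intros _ (q & _ & E). injection E as _ _ _ E. apply Hs0. rewrite E. ring.
Qed.

Lemma v_sgn_tangent_to_hyperbola
    (g : plane_geometry) (alpha beta sgn u : R) (x : vec4) :
  0 < alpha -> 0 < beta -> 0 < 1 + eps g * alpha ^ 2 ->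
  0 < 1 - eps g * beta ^ 2 ->
  proj_eq x (v_sgn sgn g alpha beta u) ->
  tangent_to g (hyperbola alpha beta) x.
Proof.
  intros Ha Hb Hea Heb (r & Hr & ->).
  pose proof (modulus_sqr g alpha beta Ha Hb Heb) as Hk.
  destruct (modulus_bounds g alpha beta Ha Hb Hea Heb) as [_ Hk1].
  pose proof (pow_lt alpha 2 Ha). pose proof (pow_lt beta 2 Hb).
  unfold v_sgn, scale4.
  set (k := modulus g alpha beta) in *.
  set (A := sqrt (1 + eps g * alpha ^ 2)). set (B := sqrt (alpha ^ 2 + beta ^ 2)).
  assert (HA : 0 < A) by now apply sqrt_lt_R0.
  assert (HB : 0 < B) by (apply sqrt_lt_R0; lra).
  (* The point of contact is the pole of the line: the inverse matrix of the conic applied to the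
     line coordinates [(x1, x2, eps' g * x3)]. Its first coordinate is nonzero because dn is
     positive. *)
  exists (alpha ^ 2 * (r * (/ A * dn u k)), - beta ^ 2 * (r * (alpha / B * sn u k)),
    - (eps' g * (r * (alpha / A * cn u k)))).
  repeat split.
  - intros E. injection E as E _ _. revert E.
    pose proof (dn_pos k u Hk1) as Hd. pose proof (Rinv_0_lt_compat _ HA).
    repeat apply Rmult_integral_contrapositive_currified; lra.
  - unfold hyperbola.
    pose proof (cn_sqr k u) as Hc. pose proof (dn_sqr k u Hk1) as Hd.
    assert (HA2 : A ^ 2 = 1 + eps g * alpha ^ 2) by (apply pow2_sqrt; lra).
    assert (HB2 : B ^ 2 = alpha ^ 2 + beta ^ 2) by (apply pow2_sqrt; lra).
    assert (He : eps' g ^ 2 = 1) by (destruct g; simpl; ring).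
    rewrite Hk in Hd.
    transitivity (r ^ 2 * alpha ^ 2 * (dn u k ^ 2 / A ^ 2
      - beta ^ 2 * sn u k ^ 2 / B ^ 2 - eps' g ^ 2 * cn u k ^ 2 / A ^ 2)).
    { field. lra. }
    rewrite HA2, HB2, Hc, Hd, He. field. lra.
  - destruct y as [[y1 y2] y3]. unfold on_line, hyperbola. intros E.
    rewrite <- E. field. lra.
  - destruct y as [[y1 y2] y3]. unfold on_line, hyperbola. intros E.
    rewrite <- E. field. lra.
Qed.

(** * Common circles and assembly of the net *)

Lemma touches_scale4 (r : R) (x a : vec4) :
  touches x a -> touches (scale4 r x) a.
Proof.
  destruct x as [[[x1 x2] x3] x4], a as [[[a1 a2] a3] a4].
  unfold touches; simpl. intros H.
  transitivity (r * (a1 * x1 + a2 * x2 + a3 * x3 + a4 * x4)); [ring |].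
  rewrite H. ring.
Qed.

Lemma v_touch_common_circle
    (g : plane_geometry) (alpha beta a b c d : R) (x y z w : vec4) :
  0 < alpha -> 0 < beta -> 0 < 1 + eps g * alpha ^ 2 ->
  0 < 1 - eps g * beta ^ 2 -> a + d = b + c ->
  proj_eq x (v_plus g alpha beta a) -> proj_eq y (v_minus g alpha beta b) ->
  proj_eq z (v_minus g alpha beta c) -> proj_eq w (v_plus g alpha beta d) ->
  touch_common_circle x y z w.
Proof.
  intros Ha Hb Hea Heb Hsum (r1 & _ & ->) (r2 & _ & ->) (r3 & _ & ->) (r4 & _ & ->).
  pose proof (pow_lt alpha 2 Ha). pose proof (pow_lt beta 2 Hb).
  destruct (jacobi_coplanar (modulus g alpha beta) a b c d)
    as (n1 & n2 & n3 & n4 & Hn & H1 & H2 & H3 & H4);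
    [now apply modulus_bounds | exact Hsum |].
  set (A := sqrt (1 + eps g * alpha ^ 2)). set (B := sqrt (alpha ^ 2 + beta ^ 2)).
  assert (HA : 0 < A) by now apply sqrt_lt_R0.
  assert (HB : 0 < B) by (apply sqrt_lt_R0; lra).
  (* The coefficients are reordered to (dn, sn, cn) and rescaled to undo the constant factors in
     [v_sgn]. *)
  exists (n3 * A, n1 * (B / alpha), n2 * (A / alpha), n4). split.
  - intros E. injection E as E3 E1 E2 E4.
    pose proof (Rdiv_lt_0_compat _ _ HA Ha). pose proof (Rdiv_lt_0_compat _ _ HB Ha).
    apply Rmult_integral in E1, E2, E3.
    apply Hn. repeat split; [destruct E1 | destruct E2 | destruct E3 |]; lra.
  - repeat split; apply touches_scale4; unfold v_plus, v_minus, v_sgn, touches;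
      fold A B;
      [rewrite <- H1 | rewrite <- H2 | rewrite <- H3 | rewrite <- H4]; field; lra.
Qed.

Theorem theorem8p10 (g : plane_geometry) (alpha beta : R)
  (halpha : 0 < alpha) (hbeta : 0 < beta)
  (hepsalpha : 0 < 1 + eps g * alpha ^ 2)
  (hepsbeta : 0 < 1 - eps g * beta ^ 2)
  (s s' u0l u0m : R) (l m : Z -> vec4)
  (hl_even : forall n : Z, proj_eq (l (2 * n)%Z)
     (v_plus g alpha beta (u0l + IZR n * (s + s'))))
  (hl_odd : forall n : Z, proj_eq (l (2 * n + 1)%Z)
     (v_minus g alpha beta (u0l + IZR n * (s + s') + s)))
  (hm_even : forall n : Z, proj_eq (m (2 * n)%Z)
     (v_minus g alpha beta (u0m + IZR n * (s + s'))))
  (hm_odd : forall n : Z, proj_eq (m (2 * n + 1)%Z)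
     (v_plus g alpha beta (u0m + IZR n * (s + s') + s))) :
  checkerboard_incircular_net g l m /\
  net_tangent_to g (hyperbola alpha beta) l m.
Proof.
  assert (Hl : forall i, exists sgn u, sgn ^ 2 = 1 /\
    proj_eq (l i) (v_sgn sgn g alpha beta u)).
  { intros i. destruct (Z.Even_or_Odd i) as [[n ->] | [n ->]];
      do 2 eexists; (split; [| apply hl_even || apply hl_odd]); ring. }
  assert (Hm : forall j, exists sgn u, sgn ^ 2 = 1 /\
    proj_eq (m j) (v_sgn sgn g alpha beta u)).
  { intros j. destruct (Z.Even_or_Odd j) as [[n ->] | [n ->]];
      do 2 eexists; (split; [| apply hm_even || apply hm_odd]); ring. }
  split; [split; [| split] | split].
  - intros i. destruct (Hl i) as (sgn & u & Hsgn & H).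
    now apply (v_sgn_oriented_line g alpha beta sgn u).
  - intros j. destruct (Hm j) as (sgn & u & Hsgn & H).
    now apply (v_sgn_oriented_line g alpha beta sgn u).
  - intros i j [q Hq].
    destruct (Z.Even_or_Odd i) as [[n ->] | [n ->]].
    + replace j with (2 * (q - n))%Z by lia.
      eapply (v_touch_common_circle g alpha beta);
        [assumption .. | | apply hl_even | apply hl_odd | apply hm_even | apply hm_odd].
      ring.
    + replace j with (2 * (q - n - 1) + 1)%Z by lia.
      replace (2 * n + 1 + 1)%Z with (2 * (n + 1))%Z by ring.
      replace (2 * (q - n - 1) + 1 + 1)%Z with (2 * (q - n - 1 + 1))%Z by ring.
      (* For odd indices the signs are exchanged, so each pair is listed in reverse to put the
         [v_plus] lines first and last. Both argument sums then contain one extra [s + s'] from the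
         shifted index. *)
      assert (H : touch_common_circle (l (2 * (n + 1))%Z) (l (2 * n + 1)%Z)
        (m (2 * (q - n - 1 + 1))%Z) (m (2 * (q - n - 1) + 1)%Z)).
      { eapply (v_touch_common_circle g alpha beta);
          [assumption .. | | apply hl_even | apply hl_odd | apply hm_even | apply hm_odd].
        rewrite !plus_IZR. ring. }
      destruct H as (a & Ha & H1 & H2 & H3 & H4). exists a. tauto.
  - intros i. destruct (Hl i) as (sgn & u & _ & H).
    now apply (v_sgn_tangent_to_hyperbola g alpha beta sgn u).
  - intros j. destruct (Hm j) as (sgn & u & _ & H).
    now apply (v_sgn_tangent_to_hyperbola g alpha beta sgn u).
Qed.
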